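(* Let $G$ be the graph on $25$ vertices $v_i, X^{(i)}, Y^{(i)}, Z^{(i)}, Q^{(i)}$ for $i \in \{0,1,2,3,4\}$ (indices taken modulo $5$), whose edges are exactly the following, for each $i$: $v_i v_{i+1}$; $X^{(i)}v_{i-2}$ and $X^{(i)}v_i$; $Y^{(i)}v_{i-1}$ and $Y^{(i)}v_{i+1}$; $Z^{(i)}v_i$ and $Z^{(i)}v_{i+2}$; $Q^{(i)}X^{(i)}$, $Q^{(i)}Y^{(i)}$ and $Q^{(i)}Z^{(i)}$. Then $\chi(G) = 4$.
   Context: This abstract graph is the output of the paper's search procedure in $G(\mathbb{Q}^3,\sqrt{t})$: $v_0,\dots,v_4$ form a $5$-cycle; for each $i$, $X^{(i)}$ is a point at distance $\sqrt t$ from both $v_{i-2}$ and $v_i$, $Y^{(i)}$ a point at distance $\sqrt t$ from both $v_{i-1}$ and $v_{i+1}$, $Z^{(i)}$ a point at distance $\sqrt t$ from both $v_i$ and $v_{i+2}$, and $Q^{(i)}$ a point at distance $\sqrt t$ from each of $X^{(i)}, Y^{(i)}, Z^{(i)}$. $\chi(G)$ denotes the chromatic number of $G$. *)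

(* Defs.v *)
From HB Require Import structures.
From mathcomp Require Import all_boot all_algebra.

Set Implicit Arguments.
Unset Strict Implicit.
Unset Printing Implicit Defensive.

Import GRing.Theory.

Record sgraph := SGraph {
  vertex :> finType;
  adj : rel vertex;
  adj_sym : symmetric adj;
  adj_irr : irreflexive adj
}.

Definition proper_coloring (G : sgraph) (k : nat) (c : {ffun G -> 'I_k}) : bool :=
  [forall x, forall y, adj x y ==> (c x != c y)].

Definition colorable (G : sgraph) (k : nat) : bool :=
  [exists c : {ffun G -> 'I_k}, proper_coloring c].

Lemma colorable_ex (G : sgraph) : exists k, colorable G k.
Proof.
exists #|G|; apply/existsP; exists [ffun x => enum_rank x].
apply/forallP => x; apply/forallP => y; apply/implyP => xy.
rewrite !ffunE; apply: contraTneq xy => /enum_rank_inj ->.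
by rewrite adj_irr.
Qed.

Definition chromatic_number (G : sgraph) : nat := ex_minn (colorable_ex G).

Inductive vtx : predArgType :=
  | v of 'Z_5
  | X of 'Z_5
  | Y of 'Z_5
  | Z of 'Z_5
  | Q of 'Z_5.

Definition vtx_enc (x : vtx) : 'Z_5 + ('Z_5 + ('Z_5 + ('Z_5 + 'Z_5))) :=
  match x with
  | v i => inl i
  | X i => inr (inl i)
  | Y i => inr (inr (inl i))
  | Z i => inr (inr (inr (inl i)))
  | Q i => inr (inr (inr (inr i)))
  end.

Definition vtx_dec (s : 'Z_5 + ('Z_5 + ('Z_5 + ('Z_5 + 'Z_5)))) : vtx :=
  match s with
  | inl i => v i
  | inr (inl i) => X i
  | inr (inr (inl i)) => Y i
  | inr (inr (inr (inl i))) => Z i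
  | inr (inr (inr (inr i))) => Q i
  end.

Lemma vtx_encK : cancel vtx_enc vtx_dec.
Proof. by case. Qed.

HB.instance Definition _ := Finite.copy vtx (can_type vtx_encK).

(* Each edge is listed in one orientation only; index arithmetic is in 'Z_5,
   i.e. modulo 5. *)
Definition arc (x y : vtx) : bool :=
  match x, y with
  | v i, v j => j == (i + 1)%R
  | X i, v j => (j == (i - 2)%R) || (j == i)
  | Y i, v j => (j == (i - 1)%R) || (j == (i + 1)%R)
  | Z i, v j => (j == i) || (j == (i + 2)%R)
  | Q i, X j => j == i
  | Q i, Y j => j == i
  | Q i, Z j => j == i
  | _, _ => false
  end.

Definition edge : rel vtx := fun x y => arc x y || arc y x.

Lemma edge_sym : symmetric edge.
Proof. by move=> x y; rewrite /edge orbC. Qed.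

Lemma edge_irr : irreflexive edge.
Proof.
by case=> i; rewrite /edge //= orbb -{1}[i]addr0 (inj_eq (addrI i)).
Qed.

Definition G25 : sgraph := SGraph edge_sym edge_irr.

(* Main.v *)
Require Import Defs.
From mathcomp Require Import all_boot all_algebra.

(** A proper 4-coloring is explicit. Conversely, suppose that there are at most
    three colors. If [v i] had a color different from those of [v (i - 2)] and
    [v (i + 2)], the cycle would read [a b c a b] around [v i], which forces
    [X i], [Y i], [Z i] to have the three distinct colors [b], [c], [a] and
    leaves no color for [Q i]. Hence every [v i] shares its color with
    [v (i - 2)] or [v (i + 2)]; it cannot share it with both, since these two
    are adjacent. So the edges of the 5-cycle with step 2 alternate between
    monochromatic and bichromatic, which is impossible as 5 is odd. *)

Import GRing.Theory.
Local Open Scope ring_scope.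

(** Otherwise [d], [a], [b], [c] would be four distinct elements. *)
Lemma third_color (T : finType) (a b c d : T) :
  (#|T| <= 3)%N -> a != b -> a != c -> b != c -> d != a -> d != b -> d = c.
Proof.
move=> T3 ab ac bc da db; apply/eqP/negPn/negP => dc.
have /card_uniqP s4 : uniq [:: d; a; b; c].
  by rewrite /= !inE !negb_or da db dc ab ac bc.
by move: (leq_trans (max_card (mem [:: d; a; b; c])) T3); rewrite s4.
Qed.

Lemma edge_colors (k : nat) (c : {ffun G25 -> 'I_k}) (x y : vtx) :
  proper_coloring c -> edge x y -> c x != c y.
Proof. by move=> /forallP/(_ x)/forallP/(_ y)/implyP. Qed.

Lemma v_repeats_color (k : nat) (c : {ffun G25 -> 'I_k}) (i : 'Z_5) :
  (k <= 3)%N -> proper_coloring c ->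
  (c (v i) == c (v (i + 2))) || (c (v i) == c (v (i - 2))).
Proof.
move=> k3 /edge_colors Pc; rewrite -[_ || _]negbK negb_or.
apply/negP => /andP[u2 u_2].
have T3 : (#|'I_k| <= 3)%N by rewrite card_ord.
have vv j l : l = j + 1 -> c (v j) != c (v l).
  by move=> ->; apply: Pc; rewrite /edge /= eqxx.
have c_2_1 : c (v (i - 2)) != c (v (i - 1)).
  by apply: vv; rewrite -addrA; congr +%R; apply/eqP.
have c_1_0 : c (v (i - 1)) != c (v i) by apply: vv; rewrite subrK.
have c01 : c (v i) != c (v (i + 1)) by apply: vv.
have c12 : c (v (i + 1)) != c (v (i + 2)) by apply: vv; rewrite -addrA.
(* The cycle closes here: [-2 = 2 + 1] modulo 5. *)
have c2_2 : c (v (i + 2)) != c (v (i - 2)).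
  by apply: vv; rewrite -addrA; congr +%R; apply/eqP.
have u_sym (x y : 'I_k) : x != y -> y != x by rewrite eq_sym.
(* Both vertices avoid the two distinct colors of [v i] and [v (i - 2)]. *)
have e2 : c (v (i + 2)) = c (v (i - 1)).
  exact: third_color T3 u_2 (u_sym _ _ c_1_0) c_2_1 (u_sym _ _ u2) c2_2.
have e1 : c (v (i + 1)) = c (v (i - 2)).
  apply: third_color T3 c_1_0 (u_sym _ _ c_2_1) u_2 _ (u_sym _ _ c01).
  by rewrite -e2.
have eX : c (X i) = c (v (i - 1)).
  by apply: third_color T3 (u_sym _ _ u_2) c_2_1 (u_sym _ _ c_1_0) _ _;
    apply: Pc; rewrite /edge /= eqxx ?orbT.
have eY : c (Y i) = c (v i).
  apply: third_color T3 c_2_1 (u_sym _ _ u_2) c_1_0 _ _; rewrite -?e1;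
    by apply: Pc; rewrite /edge /= eqxx ?orbT.
have eZ : c (Z i) = c (v (i - 2)).
  by apply: third_color T3 u2 u_2 c2_2 _ _;
    apply: Pc; rewrite /edge /= eqxx ?orbT.
have QX : c (Q i) != c (X i) by apply: Pc; rewrite /edge /= eqxx.
have QY : c (Q i) != c (Y i) by apply: Pc; rewrite /edge /= eqxx.
have : c (Q i) != c (Z i) by apply: Pc; rewrite /edge /= eqxx.
rewrite eX in QX; rewrite eY in QY; rewrite eZ => /eqP; apply.
exact: third_color T3 c_1_0 (u_sym _ _ c_2_1) u_2 QX QY.
Qed.

Lemma G25_not_colorable (k : nat) : (k <= 3)%N -> ~~ colorable G25 k.
Proof.
move=> k3; apply/existsP => -[c Pc].
pose e (i : 'Z_5) := c (v i) == c (v (i + 2)).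
have e_alt i : e (i + 2) = ~~ e i.
  have := v_repeats_color k c (i + 2) k3 Pc; rewrite addrK -/(e _).
  rewrite [c _ == c (v i)]eq_sym -/(e i) => e_or.
  have : ~~ (e i && e (i + 2)).
    apply/negP => /andP[/eqP ei2 /eqP ei4].
    (* Modulo 5, [i + 2 + 2] is [i - 1], a neighbor of [i] on the cycle. *)
    have : c (v (i + 2 + 2)) != c (v i).
      apply: edge_colors Pc _; rewrite /edge /= -!addrA.
      by rewrite -{1}[i]addr0 (inj_eq (addrI i)).
    by rewrite -ei4 -ei2 eqxx.
  by case: (e i) e_or; case: (e _).
(* Five steps of 2 return to 0, yet negate [e] an odd number of times. *)
have : e (0 + 2 + 2 + 2 + 2 + 2) = e 0 by congr e; apply: val_inj.
by rewrite !e_alt !negbK; case: (e 0).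
Qed.

Lemma G25_colorable4 : colorable G25 4.
Proof.
pose c (x : vtx) : nat := match x with
  | v i => nth 0%N [:: 0; 1; 0; 1; 2]%N i
  | Q _ => 0%N
  | _ => 3%N
  end.
have c4 x : (c x < 4)%N by case: x => // -[[|[|[|[|[|]]]]] ?].
have c_arc x y : Defs.arc x y -> c x != c y.
  by case: x => -[[|[|[|[|[|i]]]]] ?] //; case: y => -[[|[|[|[|[|j]]]]] ?].
apply/existsP; exists [ffun x => Ordinal (c4 x)].
apply/forallP => x; apply/forallP => y; apply/implyP.
by rewrite !ffunE -val_eqE => /orP[] /c_arc //=; rewrite eq_sym.
Qed.

Local Close Scope ring_scope.

Theorem theorem3 : chromatic_number G25 = 4.
Proof.
rewrite /chromatic_number; case: ex_minnP => k k_col k_min.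
apply/eqP; rewrite eqn_leq k_min ?G25_colorable4 //= ltnNge.
by apply: contraL k_col => /G25_not_colorable.
Qed.
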